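(* Fix $0<q<1$ and an integer $r\ge1$, and let $Q=1/q$. There is a constant $c_r(q)$ such that, as $n\to\infty$, \[ E^{(r)}_n=c_r(q)\,n+n\,\varpi_r(\log_Q n)+o(n), \] where $\varpi_r$ is a continuous periodic function of period $1$ (arising from the poles $z=1+2k\pi i/\log Q$, $k\ne0$), and $c_r(q)\to 2^{-r}$ as $q\to1^-$. In the permutation model (the limit $q\to1$), the expected position of the $r$th left-to-right maximum counted from the right in a uniformly random permutation of $\{1,\dots,n\}$ is $\dfrac{n}{2^r}+o(n)$.
   Context: Words $a_1\dots a_n$ have independent letters with $\mathbb P\{a_i=k\}=pq^{k-1}$, $k\ge1$, $p=1-q$. An index $i$ is a left-to-right maximum if $a_i>a_j$ for all $j<i$ (strict). Left-to-right maxima are counted from the right (the last one is the 1st, the previous one the 2nd, etc.). $E^{(r)}_n=\mathbb E[(P-1)\cdot\mathbf 1\{\text{at least } r \text{ left-to-right maxima}\}]$ where $P$ is the index of the $r$th left-to-right maximum counted from the right. For a permutation $\pi_1\dots\pi_n$, left-to-right maxima and the counting from the right are defined in the same way, and the expected position means $\mathbb E[P\cdot\mathbf 1\{\text{at least } r \text{ left-to-right maxima}\}]$. *)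

(* Defs.v *)
From HB Require Import structures.
From mathcomp Require Import all_boot all_order all_algebra all_fingroup.
From mathcomp Require Import all_classical all_reals all_analysis.
Set Implicit Arguments. Unset Strict Implicit. Unset Printing Implicit Defensive.
Import Order.TTheory GRing.Theory Num.Theory.
Import numFieldNormedType.Exports.

Definition is_ltr_max (s : seq nat) (i : nat) : bool :=
  all (fun j => nth 0 s j < nth 0 s i) (iota 0 i).

Definition ltr_maxima (s : seq nat) : seq nat :=
  [seq i <- iota 0 (size s) | is_ltr_max s i].

(* (P - 1) * 1{at least r left-to-right maxima}, where P is the (1-based)
   position of the r-th left-to-right maximum counted from the right *)
Definition word_val (r : nat) (s : seq nat) : nat :=
  if r <= size (ltr_maxima s) then nth 0 (rev (ltr_maxima s)) r.-1 else 0.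

Definition perm_val (r : nat) (s : seq nat) : nat :=
  if r <= size (ltr_maxima s) then (nth 0 (rev (ltr_maxima s)) r.-1).+1 else 0.

Local Open Scope ring_scope.

(* probability of the word a_1..a_n (letters >= 1) under independent
   geometric letters P{a_i = k} = p q^(k-1), p = 1 - q *)
Definition word_prob (R : realType) (q : R) (n : nat) (w : n.-tuple nat) : R :=
  \prod_(a <- w) ((1 - q) * q ^+ (a.-1)).

Definition E_words (R : realType) (r : nat) (q : R) (n : nat) : R :=
  fine (\esum_(w in [set w : n.-tuple nat | all (fun a => 0 < a)%N w])
          (((word_val r w)%:R * word_prob q w)%:E)).

Definition perm_seq (n : nat) (s : 'S_n) : seq nat := [seq (s i : nat) | i <- enum 'I_n].

Definition E_perm (R : realType) (r n : nat) : R :=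
  (\sum_(s : 'S_n) ((perm_val r (perm_seq s))%:R : R)) / (n`!)%:R.

(* Main.v *)
(** The [r]-th maximum from the right of a word is the [(r-1)]-th one of the prefix
  before the last record.  Reading a word from its last letter, this turns the
  expectation over words with letters at most [m] into a linear recursion in [n]
  and [m] ([below]), and convexity of [x ^+ n] gives the two-sided bound
  [q^(r(r+1)/2) 2^-r (n - O(1)) <= E_n <= 2^-r n].

  No contour integral is needed for the oscillation.  Deleting the letters 1 and
  lowering the others by one maps a geometric word of length [n] to one of
  binomial length with mean [q n], while positions shrink by a factor [q] on
  average; as [E] is 1-Lipschitz in [n], this gives
  [E_n = E_(floor (q n)) / q + O(sqrt n)].  Hence [q^j E_(floor (x q^-j))]
  converges geometrically to a Lipschitz function [H] with [H (x / q) = H x / q],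
  and [E_n = H n + O(sqrt n)].  The periodic profile is [H y / y] at
  [y = q^(-t)]; [c] is its mean, which tends to [2^-r] by the two-sided bound.

  For permutations the same last-letter recursion has the closed asymptotics
  [n / 2^r + O(1)]. *)

Require Import Defs.
From HB Require Import structures.
From mathcomp Require Import all_boot all_order all_algebra all_fingroup.
From mathcomp Require Import all_classical all_reals all_analysis.
From mathcomp Require Import ring lra.
Import Order.TTheory GRing.Theory Num.Theory.
Import numFieldNormedType.Exports.
Local Open Scope classical_set_scope.
Local Open Scope ring_scope.

Lemma lipschitz_nat (R : realType) (f : nat -> R) i j :
  (forall k, `|f k.+1 - f k| <= 1) -> `|f i - f j| <= `|i%:R - j%:R|.
Proof.
move=> f1.
have lip a b : `|f (a + b)%N - f a| <= b%:R.
  elim: b => [|b IH]; first by rewrite addn0 subrr normr0.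
  rewrite addnS (_ : _ - _ = (f (a + b).+1 - f (a + b)%N) + (f (a + b)%N - f a)).
    by rewrite (le_trans (ler_normD _ _)) // -natr1 addrC lerD.
  by ring.
have [ij|/ltnW ji] := leqP i j.
  have := lip i (j - i)%N; rewrite subnKC // natrB // distrC.
  by move/le_trans; apply; rewrite distrC ler_norm.
have := lip j (i - j)%N; rewrite subnKC // natrB //.
by move/le_trans; apply; rewrite ler_norm.
Qed.

(** * The last-letter recursion *)

Section Recursion.
Variables (R : realType) (q : R).
Hypothesis q01 : 0 < q < 1.

(* Letters are at most [k] with probability [cdf k].  [below r n m] is the
   expectation of the [r]-th position over the words of length [n] with letters at
   most [m], and [level (below r.-1) k n] its part with maximum [k.+1]: either the
   last letter is at most [k.+1] and changes nothing, or it is the only maximum. *)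
Definition cdf (k : nat) : R := 1 - q ^+ k.

Fixpoint level (src : nat -> nat -> R) (k n : nat) : R :=
  if n is n'.+1
  then cdf k.+1 * level src k n' + (1 - q) * q ^+ k * src n' k
  else 0.

Fixpoint below (r : nat) : nat -> nat -> R :=
  if r is r'.+1 then fun n m => \sum_(k < m) level (below r') k n
  else fun n m => n%:R * cdf m ^+ n.

Let q0 : 0 < q. Proof. by case/andP: q01. Qed.
Let q1 : q < 1. Proof. by case/andP: q01. Qed.
Let p0 : 0 < 1 - q. Proof. by rewrite subr_gt0. Qed.

Lemma cdf0 : cdf 0 = 0.
Proof. by rewrite /cdf expr0 subrr. Qed.

Lemma cdf_ge0 k : 0 <= cdf k.
Proof. by rewrite /cdf subr_ge0 exprn_ile1 // ltW. Qed.

Lemma cdf_le1 k : cdf k <= 1.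
Proof. by rewrite /cdf gerBl exprn_ge0 // ltW. Qed.

Lemma cdfSB k : cdf k.+1 - cdf k = (1 - q) * q ^+ k.
Proof. by rewrite /cdf exprS; ring. Qed.

Lemma cdfS_affine k : cdf k.+1 = 1 - q + q * cdf k.
Proof. by rewrite /cdf exprS; ring. Qed.

Lemma cdf_leS k : cdf k <= cdf k.+1.
Proof. by rewrite -subr_ge0 cdfSB mulr_ge0 ?exprn_ge0 // ltW. Qed.

Lemma cdf_homo : {homo cdf : k m / (k <= m)%N >-> k <= m}.
Proof. by apply: homo_leq => [//|? ? ?|k]; [exact: le_trans | exact: cdf_leS]. Qed.

Lemma pw_ge0 k : 0 <= (1 - q) * q ^+ k.
Proof. by rewrite mulr_ge0 ?exprn_ge0 // ltW. Qed.

(** Convexity: the power lies above its tangent at [a]. Multiplying case [n] by [b] leaves the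
    surplus [n.+1%:R * a ^+ n * (b - a) ^+ 2], which closes the induction. *)
Lemma tangent_exprS (a b : R) n : 0 <= a -> 0 <= b ->
  a ^+ n.+1 + n.+1%:R * a ^+ n * (b - a) <= b ^+ n.+1.
Proof.
move=> a0 b0; elim: n => [|n IH]; first by rewrite !expr1 expr0; lra.
rewrite [b ^+ _]exprS; apply: le_trans (ler_wpM2l b0 IH).
rewrite -subr_ge0.
rewrite (_ : _ - _ = n.+1%:R * a ^+ n * (b - a) ^+ 2); last first.
  by rewrite [n.+2%:R](_ : _ = n.+1%:R + 1) ?natr1 // !exprS expr0; ring.
by apply: mulr_ge0; [rewrite mulr_ge0 ?exprn_ge0 | exact: sqr_ge0].
Qed.

(** * Two-sided bounds for the recursion *)

Lemma levelS (src : nat -> nat -> R) k n : level src k n.+1 =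
  cdf k.+1 * level src k n + (1 - q) * q ^+ k * src n k.
Proof. by []. Qed.

Lemma belowS r n m : below r.+1 n m = \sum_(k < m) level (below r) k n.
Proof. by []. Qed.

Lemma level_ge0 (src : nat -> nat -> R) k n : (forall n k, 0 <= src n k) -> 0 <= level src k n.
Proof.
move=> s0; elim: n => [|n IH] //=.
by rewrite addr_ge0 // mulr_ge0 ?pw_ge0 ?cdf_ge0.
Qed.

Lemma below_ge0 r n m : 0 <= below r n m.
Proof.
elim: r n m => [|r IH] n m /=; first by rewrite mulr_ge0 // exprn_ge0 // cdf_ge0.
by apply: sumr_ge0 => k _; exact: level_ge0.
Qed.

Lemma below_leS r n m : below r.+1 n m <= below r.+1 n m.+1.
Proof.
by rewrite /= big_ord_recr /= lerDl; apply: level_ge0 => *; exact: below_ge0.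
Qed.

Lemma sum_cdf_telescope (f : R -> R) m :
  \sum_(k < m) (f (cdf k.+1) - f (cdf k)) = f (cdf m) - f 0.
Proof.
rewrite -[in f 0]cdf0 -(big_mkord xpredT (fun k => f (cdf k.+1) - f (cdf k))).
exact: (telescope_sumr (f \o cdf) (leq0n m)).
Qed.

(** With [a = cdf k] and [b = cdf k.+1], the recursion unfolds to the sum over [i < n] of
    [(b - a) * b ^+ (n.-1 - i) * src i k]. The weights [(b - a) * b ^+ (n.-1 - i) * a ^+ i] add up
    to [b ^+ n - a ^+ n] and decrease in [i], so the mean of [i] is at most [n / 2]: each rank thus
    gains a factor 1/2. The bound has a form that telescopes over [k]. *)
Lemma level_ub (C : R) (src : nat -> nat -> R) k n : 0 <= C ->
  (forall n k, src n k <= C * (n%:R * cdf k ^+ n)) ->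
  level src k n <= C / 2 * (n%:R * (cdf k.+1 ^+ n - cdf k ^+ n)).
Proof.
move=> C0 sC; elim: n => [|n IH]; first by rewrite /= mul0r mulr0.
rewrite /= -cdfSB.
set b := cdf k.+1 in IH *; set a := cdf k in IH *.
have ab : 0 <= b - a by rewrite subr_ge0 cdf_leS.
have a0 : 0 <= a by exact: cdf_ge0.
have b0 : 0 <= b by exact: cdf_ge0.
have h := lerD (ler_wpM2l (cdf_ge0 k.+1) IH) (ler_wpM2l ab (sC n k)).
apply: (le_trans h); rewrite -/a -/b; clearbody a b.
rewrite -subr_ge0.
have := @tangent_exprS a b n a0 b0.
rewrite -natr1 => T.
have an0 : 0 <= a ^+ n by rewrite exprn_ge0.
rewrite (_ : _ - _ = C / 2 * ((b ^+ n.+1 - (a ^+ n.+1 + (n%:R + 1) * a ^+ n * (b - a)))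
   + (b - a) * a ^+ n)); last by rewrite !exprS; field.
by rewrite mulr_ge0 ?divr_ge0 // addr_ge0 ?subr_ge0 // mulr_ge0.
Qed.

Lemma below_ub r n m : below r n m <= (2 ^+ r)^-1 * (n%:R * cdf m ^+ n).
Proof.
elim: r n m => [|r IH] n m; first by rewrite expr0 invr1 mul1r.
have C0 : 0 <= (2 ^+ r : R)^-1 by rewrite invr_ge0 exprn_ge0.
apply: (@le_trans _ _ (\sum_(k < m) ((2 ^+ r)^-1 / 2 *
    (n%:R * (cdf k.+1 ^+ n - cdf k ^+ n))))).
  by apply: ler_sum => k _; exact: level_ub.
rewrite -mulr_sumr -mulr_sumr (sum_cdf_telescope (fun x => x ^+ n)).
rewrite exprS invfM [X in _ <= X * _]mulrC.
apply: ler_wpM2l; first by rewrite divr_ge0.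
by rewrite ler_wpM2l // gerBl exprn_ge0.
Qed.

Lemma below_ub1 r n m : below r n m <= 1 * (n%:R * cdf m ^+ n).
Proof.
apply: le_trans (below_ub r n m) _.
rewrite ler_wpM2r // ?mulr_ge0 ?exprn_ge0 ?cdf_ge0 //.
by rewrite invf_le1 ?exprn_gt0 // exprn_ege1 // ler1n.
Qed.

Lemma below_le r n m : below r n m <= n%:R / 2 ^+ r.
Proof.
apply: le_trans (below_ub r n m) _.
rewrite mulrC ler_wpM2r ?invr_ge0 ?exprn_ge0 //.
by rewrite ler_piMr // exprn_ile1 ?cdf_ge0 ?cdf_le1.
Qed.

(** Lowering the factor [cdf k.+1] to [a = cdf (k - s)] makes all powers equal, and the sum of
    [i - c] over [i <= n] is [n.+1 * (n - 2 * c) / 2]. For a telescoping bound, [n.+1 * a ^+ n] is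
    then traded for [a ^+ n.+1 - a' ^+ n.+1] by the tangent at [a]. This costs one more unit of
    shift and the factor [q ^+ s.+1], the ratio of the letter probability to [a - a']. *)
Lemma level_lb (D c : R) (s : nat) (src : nat -> nat -> R) k n : 0 <= D ->
  (forall n k, 0 <= src n k) ->
  (forall n k, D * (n%:R - c) * cdf (k - s) ^+ n <= src n k) ->
  D * q ^+ s.+1 / 2 * (n%:R - (1 + 2 * c)) *
     (cdf (k - s) ^+ n - cdf (k - s.+1) ^+ n) <= level src k n.
Proof.
move=> D0 s0 sD; case: n => [|n]; first by rewrite !expr0 subrr mulr0.
set a := cdf (k - s); set a' := cdf (k - s.+1).
have a0 : 0 <= a by exact: cdf_ge0.
have a'a : a' <= a by apply: cdf_homo; rewrite leq_sub2l.
have aX m : a' ^+ m <= a ^+ m by rewrite lerXn2r ?nnegrE ?cdf_ge0.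
have ab : a <= cdf k.+1 by apply: cdf_homo; rewrite (leq_trans (leq_subr _ _)).
have lb : D * ((1 - q) * q ^+ k) / 2 * (n%:R - 2 * c) * (n.+1%:R * a ^+ n)
    <= level src k n.+1.
  elim: n => [|n IH].
    have h := ler_wpM2l (pw_ge0 k) (sD 0 k).
    rewrite levelS mulr0 [leRHS]add0r; apply: le_trans _ h.
    by rewrite !expr0 le_eqVlt; apply/orP; left; apply/eqP; by field.
  have L0 : 0 <= level src k n.+1 by exact: level_ge0.
  rewrite (levelS _ _ n.+1).
  have h2 := ler_wpM2l (pw_ge0 k) (sD n.+1 k).
  have h1 := le_trans (ler_wpM2l a0 IH) (ler_wpM2r L0 ab).
  rewrite -/a in h2.
  refine (le_trans _ (lerD h1 h2)).
  rewrite -!natr1 !exprS le_eqVlt; apply/orP; left; apply/eqP; by field.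
(* For [n < 2 * c] the claimed bound is nonpositive. *)
have [nc|nc] := ltP (n%:R - 2 * c) 0.
  apply: (@le_trans _ _ 0); last exact: level_ge0.
  rewrite -(natr1 n) (_ : n%:R + 1 - (1 + 2 * c) = n%:R - 2 * c); last by ring.
  apply: mulr_le0_ge0; last by rewrite subr_ge0.
  rewrite mulr_ge0_le0 // ?(ltW nc) // divr_ge0 // mulr_ge0 // exprn_ge0 //.
  exact: ltW.
apply: (le_trans _ lb).
rewrite -(natr1 n) (_ : n%:R + 1 - (1 + 2 * c) = n%:R - 2 * c); last by ring.
set x := n%:R - 2 * c in nc *.
suff H : q ^+ s.+1 * (a ^+ n.+1 - a' ^+ n.+1)
    <= (1 - q) * q ^+ k * (n.+1%:R * a ^+ n).
  have := ler_wpM2l (mulr_ge0 (divr_ge0 D0 (ler0n R 2)) nc) H.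
  rewrite natr1 => h; apply: le_trans (le_trans _ h) _;
    by rewrite le_eqVlt; apply/orP; left; apply/eqP; ring.
(* For [k <= s], truncated subtraction makes [a] and [a'] both [cdf 0], and the left side
   vanishes. *)
have [ks|ks] := leqP k s.
  rewrite /a /a' (eqP ks) (eqP (leqW ks)) subrr mulr0.
  by rewrite mulr_ge0 ?pw_ge0 // mulr_ge0 // exprn_ge0 // cdf_ge0.
have ksE : (k - s = (k - s.+1).+1)%N by rewrite -subSn // subSS.
have aa' : a - a' = (1 - q) * q ^+ (k - s.+1) by rewrite /a /a' ksE cdfSB.
have T := @tangent_exprS a a' n a0 (cdf_ge0 _).
have kE : q ^+ k = q ^+ s.+1 * q ^+ (k - s.+1) by rewrite -exprD subnKC.
have : a ^+ n.+1 - a' ^+ n.+1 <= n.+1%:R * a ^+ n * (a - a').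
  by rewrite lerBlDr -lerBlDl; move: T; rewrite -[a' - a]opprB mulrN.
move/(ler_wpM2l (exprn_ge0 s.+1 (ltW q0))) => h; apply: le_trans h _.
by rewrite aa' kE le_eqVlt; apply/orP; left; apply/eqP; ring.
Qed.

(** The losses [q ^+ s.+1] for [s < r] multiply to [q ^+ 'C(r.+1, 2)], and [2 ^ r - 1] comes from
    iterating [c -> 1 + 2 * c] from 0. The shift by [r] disappears as [m] tends to infinity. *)
Lemma below_lb r n m :
  q ^+ 'C(r.+1, 2) / 2 ^+ r * (n%:R - (2 ^ r - 1)%:R) * cdf (m - r) ^+ n
    <= below r n m.
Proof.
elim: r n m => [|r IH] n m.
  by rewrite bin_small // !expr0 divr1 mul1r expn0 subnn subr0 subn0.
set D := q ^+ 'C(r.+1, 2) / 2 ^+ r in IH.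
have D0 : 0 <= D by rewrite divr_ge0 ?exprn_ge0 // ltW.
have c1 : (2 ^ r.+1 - 1)%:R = 1 + 2 * (2 ^ r - 1)%:R :> R.
  have e : (0 < 2 ^ r)%N by rewrite expn_gt0.
  rewrite -[1]/(1%:R) -natrM -natrD; congr (_%:R).
  rewrite expnS; case: (2 ^ r)%N e => // x _.
  by rewrite mulnS subn1 subSS subn0.
have -> : q ^+ 'C(r.+2, 2) / 2 ^+ r.+1 = D * q ^+ r.+1 / 2.
  rewrite binS bin1 exprD [2 ^+ r.+1]exprS /D.
  have ? : (2 ^+ r : R) != 0 by rewrite expf_neq0.
  by field.
case: n => [|n].
  apply: (@le_trans _ _ 0); last exact: below_ge0.
  rewrite expr0 mulr1 sub0r mulrN oppr_le0 mulr_ge0 // divr_ge0 //.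
  by rewrite mulr_ge0 ?exprn_ge0 // ltW.
apply: (@le_trans _ _ (\sum_(k < m)
    (D * q ^+ r.+1 / 2 * (n.+1%:R - (1 + 2 * (2 ^ r - 1)%:R)) *
     (cdf (k - r) ^+ n.+1 - cdf (k - r.+1) ^+ n.+1)))); last first.
  by apply: ler_sum => k _; apply: level_lb => //; exact: below_ge0.
rewrite -mulr_sumr -c1.
pose g k := cdf (k - r.+1) ^+ n.+1.
rewrite -(big_mkord xpredT (fun k => cdf (k - r) ^+ n.+1 - g k)).
rewrite (eq_bigr (fun k => g k.+1 - g k)); last by move=> k _; rewrite /g subSS.
by rewrite telescope_sumr // /g sub0n cdf0 expr0n /= subr0.
Qed.

(** One more letter brings a gain, when it is a new record, and a loss, when it exceeds the
    prescribed maximum. Both lie between 0 and 1, hence so does the size of their difference. *)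
Lemma below_lip r n m :
  `|below r.+1 n.+1 m - below r.+1 n m| <= 1.
Proof.
have n10 : (n.+1%:R : R) != 0 by rewrite pnatr_eq0.
have E : below r.+1 n.+1 m - below r.+1 n m =
    \sum_(k < m) (1 - q) * q ^+ k * below r n k
    - \sum_(k < m) q ^+ k.+1 * level (below r) k n.
  rewrite !belowS -!sumrB; apply: eq_bigr => k _; rewrite levelS /cdf; ring.
have inc : 0 <= \sum_(k < m) (1 - q) * q ^+ k * below r n k <= 1.
  rewrite sumr_ge0 => [/=|k _]; last by rewrite mulr_ge0 ?pw_ge0 ?below_ge0.
  apply: (@le_trans _ _ (\sum_(k < m) (cdf k.+1 ^+ n.+1 - cdf k ^+ n.+1))).
    apply: ler_sum => k _; rewrite -cdfSB.
    have d0 : 0 <= cdf k.+1 - cdf k by rewrite subr_ge0 cdf_leS.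
    apply: le_trans (ler_wpM2l d0 (below_ub1 r n k)) _.
    have := @tangent_exprS (cdf k) (cdf k.+1) n (cdf_ge0 _) (cdf_ge0 _).
    rewrite -natr1.
    have : 0 <= cdf k ^+ n * (cdf k.+1 - cdf k).
      by rewrite mulr_ge0 ?exprn_ge0 ?cdf_ge0.
    lra.
  rewrite (sum_cdf_telescope (fun x => x ^+ n.+1)) expr0n subr0.
  by rewrite exprn_ile1 ?cdf_ge0 ?cdf_le1.
have dec : 0 <= \sum_(k < m) q ^+ k.+1 * level (below r) k n <= 1.
  rewrite sumr_ge0 => [/=|k _]; last first.
    by rewrite mulr_ge0 ?exprn_ge0 ?(ltW q0) // level_ge0 // => *; exact: below_ge0.
  (* [G] is an antiderivative of [n * x ^+ n.-1 * (1 - x)]. The loss is dominated by [n] times a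
     lower Riemann sum of it, hence by [n * G (cdf m)], which is at most [n / n.+1]. *)
  pose G x : R := (x ^+ n - n%:R / n.+1%:R * x ^+ n.+1).
  apply: (@le_trans _ _ (\sum_(k < m) (n%:R * (G (cdf k.+1) - G (cdf k))))).
    apply: ler_sum => k _.
    have q' : 0 <= q ^+ k.+1 by rewrite exprn_ge0 // ltW.
    have h := @level_ub 1 (below r) k n ler01 (below_ub1 r).
    apply: le_trans (ler_wpM2l q' h) _.
    have ba : 0 <= cdf k.+1 ^+ n - cdf k ^+ n.
      by rewrite subr_ge0 lerXn2r ?nnegrE ?cdf_ge0 ?cdf_leS.
    have qE : q ^+ k.+1 = 1 - cdf k.+1 by rewrite /cdf opprB addrC subrK.
    have := @tangent_exprS (cdf k) (cdf k.+1) n (cdf_ge0 _) (cdf_ge0 _).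
    move: q' ba; rewrite qE /G.
    set b := cdf k.+1; set a := cdf k => q' ba T.
    rewrite (_ : (1 - b) * _ = n%:R * ((1 - b) * (b ^+ n - a ^+ n) / 2)); last by ring.
    apply: ler_wpM2l => //.
    apply: (@le_trans _ _ ((1 - b) * (b ^+ n - a ^+ n))).
      by rewrite ler_pdivrMr // ler_peMr ?mulr_ge0 // ler1n.
    rewrite -subr_ge0 (_ : _ - _ = (n.+1%:R)^-1 *
       (b ^+ n.+1 - (a ^+ n.+1 + n.+1%:R * a ^+ n * (b - a)))).
      by rewrite mulr_ge0 ?invr_ge0 // subr_ge0.
    move: n10; rewrite -natr1 !exprS => n10; field.
    by rewrite n10.
  rewrite -mulr_sumr (sum_cdf_telescope G).
  have [->|n0] := posnP n; first by rewrite mul0r.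
  have -> : G 0 = 0 by rewrite /G !expr0n (gtn_eqF n0) mulr0 subrr.
  have := @tangent_exprS (cdf m) 1 n (cdf_ge0 _) ler01.
  rewrite expr1n => T.
  rewrite subr0 (_ : _ * _ = n%:R / n.+1%:R *
    (cdf m ^+ n.+1 + n.+1%:R * cdf m ^+ n * (1 - cdf m))).
    apply: mulr_ile1 => //; last by rewrite ler_pdivrMr ?ltr0n // mul1r ler_nat.
    rewrite addr_ge0 ?exprn_ge0 ?cdf_ge0 // mulr_ge0 ?subr_ge0 ?cdf_le1 //.
    by rewrite mulr_ge0 ?exprn_ge0 ?cdf_ge0.
  rewrite /G; move: n10; rewrite -natr1 !exprS => n10; field.
  by rewrite n10.
rewrite E; case/andP: inc => ? ?; case/andP: dec => ? ?.
by rewrite ler_norml; apply/andP; split; lra.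
Qed.

(* [thin f n] is the expectation of [f] at a binomial variable of parameters
   [n] and [q]. *)
Fixpoint thin (f : nat -> R) (n : nat) : R :=
  if n is n'.+1 then (1 - q) * thin f n' + q * thin (f \o succn) n' else f 0%N.

(** * Algebra and moments of binomial thinning *)

Lemma thinS f n : thin f n.+1 = (1 - q) * thin f n + q * thin (f \o succn) n.
Proof. by []. Qed.

Lemma eq_thin f g n : f =1 g -> thin f n = thin g n.
Proof.
elim: n f g => [|n IH] f g fg /=; first exact: fg.
by rewrite (IH _ g) // (IH (f \o _) (g \o succn)) // => k /=; rewrite fg.
Qed.

Lemma thinD f g n : thin (fun k => f k + g k) n = thin f n + thin g n.
Proof.
elim: n f g => [|n IH] f g //=.
rewrite IH (@eq_thin ((fun k => f k + g k) \o succn)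
  (fun k => (f \o succn) k + (g \o succn) k)) // IH.
by ring.
Qed.

Lemma thinZ a f n : thin (fun k => a * f k) n = a * thin f n.
Proof.
elim: n f => [|n IH] f //=.
by rewrite IH (@eq_thin ((fun k => a * f k) \o succn)
  (fun k => a * (f \o succn) k)) // IH; ring.
Qed.

Lemma thin_sum m (f : nat -> nat -> R) n :
  thin (fun k => \sum_(i < m) f i k) n = \sum_(i < m) thin (f i) n.
Proof.
elim: m => [|m IH].
  rewrite big_ord0 (@eq_thin _ (fun k => 0 * 0)) ?thinZ ?mul0r // => k.
  by rewrite big_ord0.
rewrite big_ord_recr /= -IH -thinD; apply: eq_thin => k.
by rewrite big_ord_recr.
Qed.

Lemma thin_le f g n : (forall k, f k <= g k) -> thin f n <= thin g n.
Proof.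
elim: n f g => [|n IH] f g fg /=; first exact: fg.
by rewrite lerD // ler_wpM2l ?(ltW p0) ?(ltW q0) // IH // => k; exact: fg.
Qed.

Lemma thin_cst a n : thin (fun=> a) n = a.
Proof. by elim: n => [//|n /= ->]; ring. Qed.

Lemma thin_expr b n : thin (fun k => b ^+ k) n = (1 - q + q * b) ^+ n.
Proof.
elim: n => [//|n IH] /=.
rewrite (@eq_thin ((fun k => b ^+ k) \o succn) (fun k => b * b ^+ k)) ?thinZ ?IH ?exprS; first ring.
by move=> k; rewrite /= exprS.
Qed.

Lemma thin_nat_expr b n :
  thin (fun k => k%:R * b ^+ k) n.+1 = n.+1%:R * (q * b) * (1 - q + q * b) ^+ n.
Proof.
elim: n => [|n IH]; first by rewrite /= mul0r expr0; ring.
rewrite thinS IH.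
rewrite (@eq_thin (_ \o succn) (fun k => b * (k%:R * b ^+ k) + b * b ^+ k)); last first.
  by move=> k; rewrite /= -natr1 exprS; ring.
rewrite thinD !thinZ IH thin_expr -!natr1 !exprS; ring.
Qed.

(** Variance plus squared bias of the binomial variable. *)
Lemma thin_sqr_dist x n : thin (fun k => (k%:R - x) ^+ 2) n =
  n%:R * (q * (1 - q)) + (n%:R * q - x) ^+ 2.
Proof.
elim: n x => [|n IH] x; first by rewrite [thin _ _]/=; ring.
rewrite thinS IH (@eq_thin (_ \o succn) (fun k => (k%:R - (x - 1)) ^+ 2)).
  by rewrite IH -natr1; ring.
by move=> k; rewrite /= -natr1; ring.
Qed.

(* The thinning identity of the header; the defect is bounded, not zero, because
   positions are counted from 0. *)
Lemma below_thin r n k :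
  0 <= below r n k.+1 - q^-1 * thin (fun j => below r j k) n
    <= q^-1 ^+ r.+1 * cdf k.+2 ^+ n.
Proof.
have qn0 : q != 0 by rewrite gt_eqF.
have qV0 m : 0 <= q^-1 ^+ m by rewrite exprn_ge0 // invr_ge0 ltW.
elim: r n k => [|r IH] n k.
  case: n => [|n]; first by rewrite [thin _ _]/= [below _ _ _]/= !mul0r mulr0 subrr lexx mulr_ge0.
  rewrite [X in thin X](_ : _ = (fun j => j%:R * cdf k ^+ j)) // thin_nat_expr.
  rewrite -cdfS_affine [below _ _ _]/=.
  have T := @tangent_exprS (cdf k.+1) (cdf k.+2) n (cdf_ge0 _) (cdf_ge0 _).
  rewrite cdfSB in T; have e := cdfSB k.
  have -> : n.+1%:R * cdf k.+1 ^+ n.+1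
      - q^-1 * (n.+1%:R * (q * cdf k) * cdf k.+1 ^+ n)
    = n.+1%:R * cdf k.+1 ^+ n * ((1 - q) * q ^+ k).
    by rewrite -e exprS; field.
  rewrite mulr_ge0 ?pw_ge0 ?mulr_ge0 ?exprn_ge0 ?cdf_ge0 //=.
  rewrite expr1 [leRHS]mulrC ler_pdivlMr //; apply: le_trans _ T.
  rewrite (_ : _ * q = n.+1%:R * cdf k.+1 ^+ n * ((1 - q) * q ^+ k.+1)).
    by rewrite lerDr exprn_ge0 // cdf_ge0.
  by rewrite exprS; ring.
(* [eps] is the defect at one level. It obeys the last-letter recursion with the rank [r] defect as
   source: since [cdf j.+2 = 1 - q + q * cdf j.+1], thinning turns the recursion at level [j] into
   the one at level [j.+1]. *)
pose eps j n := level (below r) j.+1 n - q^-1 * thin (level (below r) j) n.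
have epsS j l : eps j l.+1 = cdf j.+2 * eps j l +
    (1 - q) * q ^+ j.+1 * (below r l j.+1 - q^-1 * thin (fun i => below r i j) l).
  rewrite /eps levelS thinS.
  rewrite (@eq_thin (_ \o succn) (fun i => cdf j.+1 * level (below r) j i +
     (1 - q) * q ^+ j * below r i j)) // thinD !thinZ [cdf j.+2]cdfS_affine exprS.
  by field.
have epsP j l : 0 <= eps j l
    <= q^-1 ^+ r.+2 * (cdf j.+3 ^+ l - cdf j.+2 ^+ l).
  elim: l => [|l /andP[IH0 IH1]].
    by rewrite /eps /= mulr0 !subrr mulr0 lexx.
  rewrite epsS; have /andP[e0 e1] := IH l j.
  apply/andP; split.
    by apply: addr_ge0; apply: mulr_ge0 => //; [exact: cdf_ge0 | exact: pw_ge0].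
  apply: le_trans (lerD (ler_wpM2l (cdf_ge0 _) IH1) (ler_wpM2l (pw_ge0 _) e1)) _.
  have := cdfSB j.+2; set b3 := cdf j.+3; set b2 := cdf j.+2 => b32.
  have -> : (1 - q) * q ^+ j.+1 = q^-1 * (b3 - b2) by rewrite b32 [q ^+ j.+2]exprS; field.
  have h : 0 <= (b3 - b2) * (b3 ^+ l - b2 ^+ l).
    by rewrite mulr_ge0 // subr_ge0 ?lerXn2r ?nnegrE ?cdf_ge0 ?cdf_leS.
  rewrite -subr_ge0 (_ : _ - _ =
    q^-1 ^+ r.+2 * ((b3 - b2) * (b3 ^+ l - b2 ^+ l))).
    exact: mulr_ge0.
  by rewrite [q^-1 ^+ r.+2]exprS [b3 ^+ l.+1]exprS [b2 ^+ l.+1]exprS; ring.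
(* At level 0 all letters are 1, so the only record has index 0 and value 0. Dropping this level
   matches the remaining ones with the [k] thinned levels. *)
have level0 l : level (below r) 0 l = 0.
  elim: l => [//|l IHl]; rewrite levelS IHl mulr0 add0r.
  case: (r) => [|r'] /=; last by rewrite big_ord0 mulr0.
  by rewrite cdf0 expr0n; case: (l) => [|l']; rewrite ?mul0r ?mulr0.
have -> : below r.+1 n k.+1 - q^-1 * thin (fun j => below r.+1 j k) n
    = \sum_(j < k) eps j n.
  rewrite belowS big_ord_recl /= level0 add0r thin_sum mulr_sumr -sumrB.
  by apply: eq_bigr.
apply/andP; split; first by apply: sumr_ge0 => j _; case/andP: (epsP j n).
apply: (@le_trans _ _ (\sum_(j < k) q^-1 ^+ r.+2 *
    (cdf j.+3 ^+ n - cdf j.+2 ^+ n))).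
  by apply: ler_sum => j _; case/andP: (epsP j n).
rewrite -mulr_sumr ler_wpM2l //.
rewrite -(big_mkord xpredT (fun j => cdf j.+3 ^+ n - cdf j.+2 ^+ n)).
rewrite (telescope_sumr (fun j => cdf j.+2 ^+ n)) //.
by rewrite gerBl exprn_ge0 // cdf_ge0.
Qed.

(** A Chebyshev-type argument: with [s] the root of [n + 1], [|i - m| <= (i - m)^2 / (2 s) + s / 2],
    and the mean square distance to [m] is at most [n + 1]. Only linearity and positivity of [thin]
    enter. *)
Lemma thin_lip (f : nat -> R) n m :
  (forall i, `|f i.+1 - f i| <= 1) -> `|n%:R * q - m%:R| <= 1 ->
  `|thin f n - f m| <= Num.sqrt (n.+1%:R).
Proof.
move=> f1 nm; set s := Num.sqrt _.
have s0 : 0 < s by rewrite sqrtr_gt0 ltr0n.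
have s2 : s ^+ 2 = n.+1%:R by rewrite sqr_sqrtr.
have amgm i : `|f i - f m| <= (2 * s)^-1 * (i%:R - m%:R) ^+ 2 + s / 2.
  apply: le_trans (lipschitz_nat _ _ i m f1) _; rewrite -[(_ - _) ^+ 2]real_normK ?num_real //.
  set x := `|_ - _|; rewrite -subr_ge0.
  rewrite (_ : _ - _ = (2 * s)^-1 * (x - s) ^+ 2).
    by rewrite mulr_ge0 ?sqr_ge0 // invr_ge0 mulr_ge0 // ltW.
  by field; rewrite gt_eqF.
have ub : thin (fun i => (2 * s)^-1 * (i%:R - m%:R) ^+ 2 + s / 2) n <= s.
  rewrite thinD thinZ thin_cst thin_sqr_dist.
  rewrite -lerBrDr (_ : s - s / 2 = (2 * s)^-1 * s ^+ 2); last first.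
    by field; rewrite gt_eqF.
  rewrite ler_wpM2l ?invr_ge0 ?mulr_ge0 ?(ltW s0) // s2 -natr1 lerD //.
    rewrite ler_piMr // mulr_ile1 ?(ltW q0) ?(ltW q1) ?(ltW p0) //.
    by rewrite gerBl ltW.
  by rewrite -real_normK ?num_real // expr_le1.
have -> : thin f n - f m = thin (fun i => f i - f m) n by rewrite thinD thin_cst.
rewrite ler_norml; apply/andP; split; last first.
  apply: le_trans _ ub; apply: thin_le => i.
  by apply: le_trans _ (amgm i); exact: ler_norm.
rewrite lerNl -mulN1r -thinZ; apply: le_trans _ ub; apply: thin_le => i.
by apply: le_trans _ (amgm i); rewrite mulN1r -normrN; exact: ler_norm.
Qed.

End Recursion.
Arguments cdf {R} q k.
Arguments level {R} q src k n.
Arguments below {R} q r n m.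
Arguments thin {R} q f n.

(** * Geometric words *)

Lemma esumZl (R : realType) (T : choiceType) (D : set T) (c : R) (f : T -> \bar R) :
  0 <= c -> (forall x, 0%E <= f x)%E ->
  (\esum_(x in D) (c%:E * f x) = c%:E * \esum_(x in D) f x)%E.
Proof.
move=> c0 f0; rewrite /esum -ereal_supZl //; last first.
  by apply/set0P; exists 0%E; exists set0; rewrite ?fsbig_set0 //; exact: fsets_set0.
congr ereal_sup; apply/seteqP; split=> [_ [X DX <-]|_ [_ [X DX <-] <-]].
  by exists (\sum_(i \in X) f i)%E; [exists X | rewrite ge0_mule_fsumr].
by exists X => //; rewrite ge0_mule_fsumr.
Qed.

Lemma esum_nat_finite (R : realType) (f : nat -> \bar R) m :
  (forall a, 0%E <= f a)%E -> (forall a, (m <= a)%N -> f a = 0%E) ->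
  (\esum_(a in [set: nat]) f a = \sum_(a < m) f a)%E.
Proof.
move=> f0 fm; rewrite -nneseries_esumT // (nneseries_split 0 m) //.
rewrite add0n big_mkord eseries0 ?adde0 // => i mi _; exact: fm.
Qed.

Lemma ltr_maxima_rcons s a : ltr_maxima (rcons s a) =
  if all (fun x => (x < a)%N) s then rcons (ltr_maxima s) (size s)
  else ltr_maxima s.
Proof.
rewrite /ltr_maxima size_rcons -addn1 iotaD filter_cat add0n /=.
have -> : [seq i <- iota 0 (size s) | is_ltr_max (rcons s a) i] =
          [seq i <- iota 0 (size s) | is_ltr_max s i].
  apply: eq_in_filter => i; rewrite mem_iota add0n /= => il.
  apply: eq_in_all => j; rewrite mem_iota add0n /= => ji.
  by rewrite !nth_rcons il (ltn_trans ji il).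
have -> : is_ltr_max (rcons s a) (size s) = all (fun x => (x < a)%N) s.
  rewrite /is_ltr_max nth_rcons ltnn eqxx -[in RHS](mkseq_nth 0%N s) all_map.
  apply: eq_in_all => j; rewrite mem_iota add0n /= => js.
  by rewrite nth_rcons js.
by case: ifP => _; rewrite ?cats0 // cats1.
Qed.

(* The word contributes its length at r = 0: the position that a new record
   appended to it would get. *)
Definition rank_val (r : nat) (s : seq nat) : nat :=
  if r is r'.+1 then word_val r'.+1 s else size s.

(** A new record becomes the first from the right and raises the rank of every older one; any other
    letter leaves the records unchanged. *)
Lemma rank_val_rcons r s a : rank_val r.+1 (rcons s a) =
  if all (fun x => (x < a)%N) s then rank_val r s else rank_val r.+1 s.
Proof.
rewrite /rank_val /word_val ltr_maxima_rcons; case: (all _ _) => //.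
rewrite size_rcons rev_rcons /= ltnS.
by case: r => [|r]; rewrite //= ltnS.
Qed.

Definition seq_max (s : seq nat) : nat := \max_(a <- s) a.

Lemma seq_max_rcons s a : seq_max (rcons s a) = maxn (seq_max s) a.
Proof. by rewrite /seq_max -cats1 big_cat big_seq1. Qed.

Lemma all_lt_seq_max s a : all (fun x => (x < a.+1)%N) s = (seq_max s <= a)%N.
Proof.
elim/last_ind: s => [|s x IH]; first by rewrite /seq_max big_nil.
by rewrite all_rcons seq_max_rcons geq_max IH andbC ltnS.
Qed.

(** * Expectations over geometric words, by last letter *)

Section Words.
Variables (R : realType) (q : R).
Hypothesis q01 : 0 < q < 1.

Let q0 : 0 < q. Proof. by case/andP: q01. Qed.
Let q1 : q < 1. Proof. by case/andP: q01. Qed.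

Definition pos_words n := [set w : n.-tuple nat | all (fun a => 0 < a)%N w].

(** [word_prob] on bare sequences, so that splitting off a letter needs no tuple cast. *)
Definition wprob (s : seq nat) : R := \prod_(a <- s) ((1 - q) * q ^+ a.-1).

Lemma wprob_ge0 s : 0 <= wprob s.
Proof. by apply: prodr_ge0 => a _; exact: pw_ge0. Qed.

Lemma wprob_rcons s a : wprob (rcons s a.+1) = (1 - q) * q ^+ a * wprob s.
Proof. by rewrite /wprob -cats1 big_cat big_seq1 /= mulrC. Qed.

Definition wexp n (f : seq nat -> R) : \bar R :=
  (\esum_(w in pos_words n) (f w * wprob w)%:E)%E.

Lemma wexp_ge0 n (f : seq nat -> R) : (forall s, 0 <= f s) -> (0 <= wexp n f)%E.
Proof.
by move=> f0; apply: esum_ge0 => w _; rewrite lee_fin mulr_ge0 ?wprob_ge0.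
Qed.

Lemma eq_wexp n (f g : seq nat -> R) :
  (forall s, all (fun a => 0 < a)%N s -> size s = n -> f s = g s) ->
  wexp n f = wexp n g.
Proof. by move=> fg; apply: eq_esum => w pw; rewrite fg ?size_tuple. Qed.

Lemma wexpD n (f g : seq nat -> R) : (forall s, 0 <= f s) -> (forall s, 0 <= g s) ->
  (wexp n (fun s => f s + g s)%R = wexp n f + wexp n g)%E.
Proof.
move=> f0 g0; rewrite /wexp -esumD.
- by apply: eq_esum => w _; rewrite mulrDl EFinD.
- by move=> w _; rewrite lee_fin mulr_ge0 ?wprob_ge0.
- by move=> w _; rewrite lee_fin mulr_ge0 ?wprob_ge0.
Qed.

Lemma wexpZ n (c : R) (f : seq nat -> R) : 0 <= c -> (forall s, 0 <= f s) ->
  (wexp n (fun s => c * f s)%R = c%:E * wexp n f)%E.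
Proof.
move=> c0 f0; rewrite /wexp -esumZl //.
  by apply: eq_esum => w _; rewrite -mulrA EFinM.
by move=> w; rewrite lee_fin mulr_ge0 ?wprob_ge0.
Qed.

Lemma wexp_sum m n (f : nat -> seq nat -> R) : (forall i s, 0 <= f i s) ->
  (wexp n (fun s => \sum_(i < m) f i s)%R = \sum_(i < m) wexp n (f i))%E.
Proof.
move=> f0; rewrite /wexp -esum_sum.
  by apply: eq_esum => w _; rewrite mulr_suml sumEFin.
by move=> w i _ _; rewrite lee_fin mulr_ge0 ?wprob_ge0.
Qed.

Lemma wexp0 (f : seq nat -> R) : 0 <= f [::] -> wexp 0 f = (f [::])%:E.
Proof.
move=> f0; rewrite /wexp (_ : pos_words 0 = [set [tuple]]); last first.
  by apply/seteqP; split=> [w _|w ->] //=; rewrite [w]tuple0.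
by rewrite esum_set1 /wprob ?big_nil ?mulr1 ?lee_fin.
Qed.

(** A word is a prefix and a last letter. The second hypothesis on [f] makes the sum over that
    letter finite. *)
Lemma wexpS n (f : seq nat -> R) (m : nat) : (forall s, 0 <= f s) ->
  (forall s a, (m <= a)%N -> f (rcons s a.+1) = 0) ->
  wexp n.+1 f = wexp n (fun s => \sum_(a < m) (1 - q) * q ^+ a * f (rcons s a.+1)).
Proof.
move=> f0 fm; rewrite /wexp.
pose e (x : n.-tuple nat * nat) : n.+1.-tuple nat := [tuple of rcons x.1 x.2.+1].
rewrite (reindex_esum (pos_words n `*`` (fun=> [set: nat])) _ e); last first.
  split.
  - by move=> [w a] [/= pw _]; rewrite /pos_words /= all_rcons.
  - move=> [w a] [w' a'] _ _ /(congr1 val) /= /rcons_inj [ww' aa'].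
    by congr pair => //; apply: val_inj.
  - move=> w; rewrite /pos_words /=; case: w => s /= ss.
    case/lastP: s ss => [//|s a] ss; rewrite all_rcons => /andP[a0 ps].
    have sn : size s == n by move: ss; rewrite size_rcons.
    exists (Tuple sn, a.-1) => //; apply: val_inj => /=.
    by rewrite prednK.
rewrite -(@esum_esum _ _ _ _ _
  (fun (w : n.-tuple nat) a => (f (rcons w a.+1) * wprob (rcons w a.+1))%:E)); last first.
  by move=> w a _ _; rewrite lee_fin mulr_ge0 ?wprob_ge0.
apply: eq_esum => w _; rewrite (@esum_nat_finite _ _ m).
- rewrite sumEFin mulr_suml; congr (_%:E); apply: eq_bigr => a _.
  by rewrite wprob_rcons; ring.
- by move=> a; rewrite lee_fin mulr_ge0 ?wprob_ge0.
- by move=> a ma; rewrite fm // mul0r.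
Qed.

Definition rank_lvl r k s : R := (rank_val r s)%:R * (seq_max s == k)%:R.
Definition rank_below r k s : R := (rank_val r s)%:R * (seq_max s <= k)%:R.

Lemma rank_belowE r k s : rank_below r k s = \sum_(j < k.+1) rank_lvl r j s.
Proof.
rewrite /rank_below /rank_lvl -mulr_sumr; congr (_ * _).
elim: k => [|k IH]; first by rewrite big_ord1 leqn0.
rewrite big_ord_recr -IH /= leq_eqVlt ltnS addrC.
by case: eqVneq => [->|_] /=; rewrite ?ltnn ?addr0 ?add0r.
Qed.

Lemma sum_pw m : \sum_(a < m) (1 - q) * q ^+ a = cdf q m.
Proof.
elim: m => [|m IH]; first by rewrite big_ord0 cdf0.
by rewrite big_ord_recr /= IH -cdfSB [LHS]addrC subrK.
Qed.

Lemma wexp_below0 n k : wexp n (rank_below 0 k) = (below q 0 n k)%:E.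
Proof.
have H : wexp n (fun s => (seq_max s <= k)%:R) = (cdf q k ^+ n)%:E.
  elim: n => [|n IH]; first by rewrite wexp0 /seq_max big_nil.
  rewrite (@wexpS _ _ k) //; last first.
    by move=> s a ka; rewrite seq_max_rcons geq_max [(a < k)%N]ltnNge ka andbF.
  rewrite exprS EFinM -IH -wexpZ ?cdf_ge0 //.
  apply: eq_wexp => s _ _; rewrite -sum_pw mulr_suml; apply: eq_bigr => a _.
  by rewrite seq_max_rcons geq_max ltn_ord andbT.
rewrite /below EFinM -H -wexpZ //.
by apply: eq_wexp => s _ ns; rewrite /rank_below /= ns.
Qed.

(** The two parts feed each other: levels of rank [r.+1] use the rank [r] words as source, and the
    next [below] sums these levels. Level [k] stands for maximum [k.+1] because letters start at
    1. *)
Lemma wexp_rank r :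
  (forall n k, wexp n (rank_below r k) = (below q r n k)%:E) /\
  (forall n k, wexp n (rank_lvl r.+1 k.+1) = (level q (below q r) k n)%:E).
Proof.
suff H r' : (forall n k, wexp n (rank_below r' k) = (below q r' n k)%:E) ->
    forall n k, wexp n (rank_lvl r'.+1 k.+1) = (level q (below q r') k n)%:E.
  elim: r => [|r [IH1 IH2]]; first by split; [exact: wexp_below0|exact/H/wexp_below0].
  suff B n k : wexp n (rank_below r.+1 k) = (below q r.+1 n k)%:E.
    by split=> //; exact: H.
  rewrite (eq_wexp _ _ (fun s => \sum_(j < k) rank_lvl r.+1 j.+1 s)).
    rewrite (@wexp_sum k n (fun j => rank_lvl r.+1 j.+1)) => [|i s]; last by rewrite mulr_ge0.
    by rewrite belowS -sumEFin; apply: eq_bigr => j _.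
  (* Maximum 0 forces the empty word, which has value 0. *)
  move=> s ps _; rewrite rank_belowE big_ord_recl [X in X + _](_ : _ = 0) ?add0r //.
  case: s ps => [|a s]; first by rewrite /rank_lvl /= mul0r.
  case: a => // a _; rewrite /rank_lvl /seq_max big_cons (_ : _ == _ = false).
    by rewrite mulr0.
  by apply/negbTE; rewrite -lt0n leq_max.
move=> Hb n k; elim: n => [|n IH].
  by rewrite wexp0 /rank_lvl /= mul0r.
have l0 s : 0 <= rank_lvl r'.+1 k.+1 s by rewrite /rank_lvl mulr_ge0.
have b0 s : 0 <= rank_below r' k s by rewrite /rank_below mulr_ge0.
rewrite (@wexpS _ _ k.+1) //.
- rewrite levelS EFinD !EFinM -IH -Hb -EFinM -!wexpZ ?cdf_ge0 ?pw_ge0 //.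
  rewrite -wexpD.
  + apply: eq_wexp => s _ _.
    (* If the prefix stays at or below [k], only the last letter [k.+1] reaches the maximum, and it
       is a record. Otherwise a last letter of at most [k.+1] is no record, since ties do not
       count. *)
    have [sk|sk] := leqP (seq_max s) k.
      rewrite big_ord_recr [LHS]/= big1 ?add0r => [|a _].
        rewrite /rank_lvl rank_val_rcons all_lt_seq_max sk seq_max_rcons.
        rewrite (maxn_idPr _) ?leqW // eqxx mulr1.
        by rewrite /rank_below sk mulr1 ltn_eqF ?ltnS // !mulr0 add0r.
      rewrite /rank_lvl seq_max_rcons ltn_eqF ?mulr0 //.
      by rewrite gtn_max ltnS sk /= ltnS.
    rewrite /rank_below leqNgt sk !mulr0 addr0 -sum_pw mulr_suml.
    apply: eq_bigr => a _; rewrite /rank_lvl rank_val_rcons all_lt_seq_max.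
    have as_ : (a < seq_max s)%N by rewrite (leq_trans (ltn_ord a)).
    by rewrite leqNgt as_ seq_max_rcons (maxn_idPl _).
  + by move=> s; rewrite mulr_ge0 ?cdf_ge0 // /rank_lvl mulr_ge0.
  + by move=> s; rewrite mulr_ge0 ?pw_ge0 // /rank_below mulr_ge0.
- move=> s a ka; rewrite /rank_lvl seq_max_rcons gtn_eqF ?mulr0 //.
  by rewrite leq_max ltnS ka orbT.
Qed.

(** Splitting words by their maximum makes the [below] values partial sums of the expectation. They
    are monotone and bounded, so [fine] is applied to a finite value. *)
Lemma below_cvg_E r n : 
  (fun m => below q r.+1 n m) @ \oo --> E_words r.+1 q n.
Proof.
have E : \esum_(w in pos_words n) (((word_val r.+1 w)%:R * word_prob q w)%:E) =
   (\sum_(j <oo) wexp n (rank_lvl r.+1 j))%E.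
  rewrite nneseries_esumT; last by move=> j; apply: wexp_ge0 => s; rewrite mulr_ge0.
  pose J j := pos_words n `&` [set w : n.-tuple nat | seq_max w == j].
  have -> : pos_words n = \bigcup_(j in [set: nat]) J j.
    apply/seteqP; split=> [w pw|w [j _ []]] //.
    by exists (seq_max w) => //; split=> //=.
  rewrite esum_bigcupT; first last.
  - by move=> w; rewrite lee_fin mulr_ge0 // wprob_ge0.
  - by move=> i j _ _ [w [[_ /eqP <-] [_ /eqP <-]]].
  apply: eq_esum => j _; rewrite esum_mkcondr; apply: eq_esum => w _.
  rewrite (_ : (w \in _) = (seq_max w == j)); last by apply/idP/idP; rewrite inE.
  by rewrite /rank_lvl; case: eqP => _; rewrite ?mulr1 ?mulr0 ?mul0r.
have P m : (\sum_(0 <= j < m.+1) wexp n (rank_lvl r.+1 j) = (below q r.+1 n m)%:E)%E.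
  have [<- _] := wexp_rank r.+1.
  rewrite big_mkord -(@wexp_sum m.+1 n (rank_lvl r.+1)) => [|i s]; last by rewrite mulr_ge0.
  by apply: eq_wexp => s _ _; rewrite rank_belowE.
have C : cvgn (fun m => below q r.+1 n m).
  apply: nondecreasing_is_cvgn.
    by apply/nondecreasing_seqP => m; exact: below_leS.
  exists (n%:R / 2 ^+ r.+1) => _ [m _ <-]; exact: below_le.
suff -> : E_words r.+1 q n = limn (fun m => below q r.+1 n m) by [].
rewrite /E_words E.
have -> : (\sum_(j <oo) wexp n (rank_lvl r.+1 j) = limn (fun m => (below q r.+1 n m)%:E))%E.
  have : ((fun m => \sum_(0 <= j < m) wexp n (rank_lvl r.+1 j)) @ \oo -->
      \sum_(j <oo) wexp n (rank_lvl r.+1 j))%E.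
    by apply: is_cvg_nneseries => j _ _; apply: wexp_ge0 => s; rewrite mulr_ge0.
  rewrite -cvg_shiftS => /cvg_lim <- //; congr (limn _).
  by apply/funext => m /=; rewrite P.
by rewrite EFin_lim.
Qed.

End Words.

(** * Random permutations *)

Lemma ltr_maxima_map (f : nat -> nat) s : {mono f : x y / (x < y)%N} ->
  ltr_maxima (map f s) = ltr_maxima s.
Proof.
move=> fm; rewrite /ltr_maxima size_map; apply: eq_in_filter => i.
rewrite mem_iota add0n /= => il; apply: eq_in_all => j.
rewrite mem_iota add0n /= => ji.
by rewrite !(nth_map 0%N) ?fm // (ltn_trans ji).
Qed.

(** Analogue of [rank_val] with positions counted from 1, hence the successor at rank 0. *)
Definition perm_rank (r : nat) (s : seq nat) : nat :=
  if r is r'.+1 then perm_val r'.+1 s else (size s).+1.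
Arguments perm_rank : simpl never.

Lemma perm_rank_rcons r s a : perm_rank r.+1 (rcons s a) =
  if all (fun x => (x < a)%N) s then perm_rank r s else perm_rank r.+1 s.
Proof.
rewrite /perm_rank /perm_val ltr_maxima_rcons; case: (all _ _) => //.
rewrite size_rcons rev_rcons /= ltnS.
by case: r => [|r]; rewrite //= ltnS.
Qed.

Lemma perm_rank_map (f : nat -> nat) r s : {mono f : x y / (x < y)%N} ->
  perm_rank r (map f s) = perm_rank r s.
Proof.
by move=> fm; case: r => [|r]; rewrite /perm_rank ?size_map // /perm_val ltr_maxima_map.
Qed.

(** The last value is [j], and the rest is the pattern [t] relabelled increasingly around [j], which
    preserves its records. *)
Lemma perm_seq_lift n (j : 'I_n.+1) (t : 'S_n) :
  perm_seq (lift_perm ord_max j t) = rcons (map (bump j) (perm_seq t)) j.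
Proof.
rewrite /perm_seq enum_ordSr map_rcons lift_perm_id -!map_comp; congr rcons.
apply: eq_map => i /=.
have -> : widen_ord (leqnSn n) i = lift ord_max i.
  by apply: val_inj; rewrite /= /bump leqNgt ltn_ord.
by rewrite lift_perm_lift.
Qed.

Lemma bump_lt_mono h : {mono bump h : x y / (x < y)%N}.
Proof. by move=> x y; rewrite !ltnNge leq_bump2. Qed.

Lemma all_lt_perm_seq n (j : 'I_n.+1) (t : 'S_n) :
  all (fun x => (x < j)%N) (map (bump j) (perm_seq t)) = (n <= j)%N.
Proof.
rewrite all_map; apply/allP/idP => [h|nj x /mapP[i _ ->] /=].
  rewrite leqNgt; apply/negP => jn.
  have /h : val (t (t^-1 (Ordinal jn))%g) \in perm_seq t.
    by apply: map_f; rewrite mem_enum.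
  by rewrite permKV /= /bump leqnn ltnNge leq_addl.
have tj := leq_trans (ltn_ord (t i)) nj.
by rewrite (_ : bump j (t i) = t i) // /bump leqNgt tj.
Qed.

Lemma sum_lift_perm n (F : 'S_n.+1 -> nat) :
  (\sum_(s : 'S_n.+1) F s = \sum_(j < n.+1) \sum_(t : 'S_n) F (lift_perm ord_max j t))%N.
Proof.
rewrite pair_bigA /= (reindex (fun x : 'I_n.+1 * 'S_n => lift_perm ord_max x.1 x.2)) //.
apply: onW_bij; apply: inj_card_bij.
  move=> [j t] [j' t'] /= e.
  have jj : j = j' by rewrite -(lift_perm_id ord_max j t) e lift_perm_id.
  subst j'; congr pair; apply/permP => i; apply: (@lift_inj _ j).
  by rewrite -!(lift_perm_lift ord_max) e.
by rewrite card_prod card_ord !card_Sn.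
Qed.

Definition perm_total r n : nat := (\sum_(s : 'S_n) perm_rank r (perm_seq s))%N.

(** Among the [n.+1] last values only the largest is a record; each of the other [n] leaves the
    records of the pattern. *)
Lemma perm_totalS r n :
  perm_total r.+1 n.+1 = (perm_total r n + n * perm_total r.+1 n)%N.
Proof.
rewrite /perm_total sum_lift_perm big_ord_recr /= addnC; congr addn.
  apply: eq_bigr => t _.
  rewrite perm_seq_lift perm_rank_rcons all_lt_perm_seq /= leqnn.
  by rewrite perm_rank_map //; exact: bump_lt_mono.
rewrite (eq_bigr (fun=> \sum_(s : 'S_n) perm_rank r.+1 (perm_seq s))%N).
  by rewrite sum_nat_const card_ord.
move=> j _; apply: eq_bigr => t _.
rewrite perm_seq_lift perm_rank_rcons all_lt_perm_seq /= leqNgt ltn_ord /=.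
exact: (@perm_rank_map _ r.+1 _ (bump_lt_mono _)).
Qed.

(** After division by [n.+1]!, [n / 2 ^+ r] solves the recursion up to [(2 ^+ r.+1)^-1 / n.+1]. The
    errors satisfy [r.+1 + n * r.+2 + 1 = n.+1 * r.+2], so the bound grows by 1 per rank. *)
Lemma perm_total_bound (R : realType) r n :
  `|(perm_total r n)%:R / n`!%:R - n%:R / 2 ^+ r| <= r.+1%:R :> R.
Proof.
have fn0 k : (k`!%:R : R) != 0 by rewrite pnatr_eq0 -lt0n fact_gt0.
elim: r n => [|r IHr] n.
  rewrite /perm_total (eq_bigr (fun=> n.+1)) => [|s _]; last first.
    by rewrite /perm_rank size_map size_enum_ord.
  rewrite sum_nat_const card_Sn natrM mulrAC divff // mul1r divr1.
  by rewrite -natr1 addrAC subrr add0r normr1.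
elim: n => [|n IHn].
  rewrite /perm_total big1 ?mul0r ?subrr ?normr0 // => s _.
  by rewrite /perm_seq enum_ord0.
have n0 : (n.+1%:R : R) != 0 by rewrite pnatr_eq0.
have t0 : (2 ^+ r : R) != 0 by rewrite expf_neq0.
set x := perm_total _ _ in IHn; have := IHr n; set y := perm_total _ _ => IH.
rewrite perm_totalS -/x -/y.
rewrite (_ : _ - _ = n.+1%:R^-1 * ((y%:R / n`!%:R - n%:R / 2 ^+ r) +
   (n%:R * (x%:R / n`!%:R - n%:R / 2 ^+ r.+1) - (2 ^+ r.+1)^-1))); last first.
  rewrite factS natrD !natrM exprS -natr1.
  by field; rewrite natr1 n0 t0 fn0.
rewrite normrM normfV normr_nat mulrC ler_pdivrMr ?ltr0n //.
apply: le_trans (ler_normD _ _) _.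
apply: le_trans (lerD IH (ler_normB _ _)) _.
have s1 : `|(2 ^+ r.+1)^-1 : R| <= 1.
  by rewrite ger0_norm ?invr_ge0 ?exprn_ge0 // invf_le1 ?exprn_gt0 // exprn_ege1 // ler1n.
rewrite normrM normr_nat.
have := lerD (lerD (lexx r.+1%:R) (ler_wpM2l (ler0n R n) IHn)) s1.
rewrite -addrA => /le_trans; apply.
by rewrite -(natr1 n) -(natr1 r.+1) le_eqVlt; apply/orP; left; apply/eqP; ring.
Qed.

(** * From square-root errors to the limit *)

Lemma cvg_div_nat0 (R : realType) (u : nat -> R) (K : R) :
  (forall n, `|u n| <= K * Num.sqrt n.+1%:R) ->
  (fun n => u n / n%:R) @ \oo --> (0 : R).
Proof.
move=> uK.
(* For [n >= 1], [n + 1 <= 2 n] bounds [sqrt (n + 1) / n] by [2 / sqrt (n + 1)]. *)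
have H : (fun n => (2 * K) * Num.sqrt (harmonic n : R)) @ \oo --> (0 : R).
  rewrite -(mulr0 (2 * K)); apply: cvgMr.
  rewrite -[X in _ --> X]sqrtr0.
  apply: continuous_cvg; [exact: sqrt_continuous | exact: cvg_harmonic].
apply/norm_cvg0P.
apply: (@squeeze_cvgr _ _ _ _ (fun=> 0)
  (fun n => (2 * K) * Num.sqrt (harmonic n : R))) => //; last exact: cvg_cst.
near=> n.
have n0 : (0 < n)%N by near: n; exact: nbhs_infty_gt.
rewrite normr_ge0 /= normrM normfV normr_nat ler_pdivrMr ?ltr0n //.
apply: le_trans (uK n) _.
set s := Num.sqrt _.
have s0 : 0 < s by rewrite sqrtr_gt0 ltr0n.
have K0 : 0 <= K by rewrite -(pmulr_lge0 _ s0); apply: le_trans (uK n).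
rewrite /harmonic /= sqrtrV -/s // -!mulrA mulrCA ler_wpM2l //.
rewrite mulrCA ler_pdivlMl // -expr2 sqr_sqrtr // -natrM ler_nat.
by rewrite ?mul2n ?muln2 -addnn -addn1 leq_add2l.
Unshelve. all: by end_near. Qed.

Lemma E_perm_asymptotics (R : realType) r : (0 < r)%N ->
  (fun n : nat => (E_perm R r n - n%:R / 2 ^+ r) / n%:R) @ \oo --> (0 : R).
Proof.
case: r => // r _; apply: (@cvg_div_nat0 _ _ r.+2%:R) => n.
rewrite /E_perm -natr_sum -/(perm_total r.+1 n).
apply: le_trans (perm_total_bound _ _ _) _.
by rewrite ler_peMr // -[leLHS]sqrtr1 ler_wsqrtr // ler1n.
Qed.

(** * Approximately homogeneous Lipschitz sequences *)

Lemma cvgn_le (R : realType) (u : nat -> R) (l C : R) :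
  u @ \oo --> l -> (forall n, u n <= C) -> l <= C.
Proof.
move=> ul uC; have <- : limn u = l by exact: cvg_lim.
by apply: limr_le; [apply/cvg_ex; exists l | near=> n].
Unshelve. all: by end_near. Qed.

Lemma cvgn_norm_le (R : realType) (u : nat -> R) (l C : R) :
  u @ \oo --> l -> (forall n, `|u n| <= C) -> `|l| <= C.
Proof. by move=> ul; apply: cvgn_le; exact: cvg_norm. Qed.

Lemma le_cvgn (R : realType) (u v : nat -> R) (l l' : R) :
  u @ \oo --> l -> v @ \oo --> l' -> (forall n, u n <= v n) -> l <= l'.
Proof.
move=> ul vl uv; rewrite -subr_le0; apply: (@cvgn_le _ (fun n => u n - v n)).
  exact: cvgB.
by move=> n; rewrite subr_le0.
Qed.

Section Scaling.
Variables (R : realType) (q : R) (E : nat -> R) (K B D c : R).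
Hypothesis q01 : 0 < q < 1.
Hypothesis E_lip : forall n, `|E n.+1 - E n| <= 1.
Hypothesis E_scale : forall n m, `|n%:R * q - m%:R| <= 1 ->
  `|E n - q^-1 * E m| <= K * Num.sqrt n.+1%:R.
Hypothesis E_ge0 : forall n, 0 <= E n.
Hypothesis E_ub : forall n, E n <= B * n%:R.
Hypothesis D0 : 0 <= D.
Hypothesis E_lb : forall n, D * (n%:R - c) <= E n.

Let q0 : 0 < q. Proof. by case/andP: q01. Qed.
Let q1 : q < 1. Proof. by case/andP: q01. Qed.
Let qn0 : q != 0. Proof. by rewrite gt_eqF. Qed.

Local Notation rho := (Num.sqrt q).

Let rho0 : 0 <= rho. Proof. exact: sqrtr_ge0. Qed.
Let rho1 : rho < 1.
Proof. by rewrite -[ltRHS]sqrtr1 ltr_sqrt. Qed.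
Let rho2 : rho ^+ 2 = q. Proof. by rewrite sqr_sqrtr // ltW. Qed.

Definition rescaled (x : R) (j : nat) : R := q ^+ j * E (Num.truncn (x * q^-1 ^+ j)).

Let K0 : 0 <= K.
Proof.
have := @E_scale 0 0; rewrite mul0r subrr normr0 => /(_ ler01).
by rewrite sqrtr1 mulr1; apply: le_trans.
Qed.

Let qXV j : q ^+ j * q^-1 ^+ j = 1.
Proof. by rewrite -exprMn divff // expr1n. Qed.

Let qX0 j : 0 <= q ^+ j. Proof. by rewrite exprn_ge0 // ltW. Qed.
Let qVX1 j : 1 <= q^-1 ^+ j.
Proof. by rewrite exprn_ege1 // invf_ge1 // ltW. Qed.
Let qVX0 j : 0 <= q^-1 ^+ j. Proof. exact: le_trans (qVX1 j). Qed.

(** The floors [n] of [y] and [m] of [y * q] satisfy [|n * q - m| <= 1], so [E_scale] applies. Its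
    square root grows like [rho ^- j.+1], and the prefactor [q ^+ j.+1] leaves [rho ^+ j.+1]. *)
Lemma rescaled_step x j : 0 <= x ->
  `|rescaled x j.+1 - rescaled x j| <= K * Num.sqrt (x + 1) * rho ^+ j.+1.
Proof.
move=> x0; rewrite /rescaled.
set y := x * q^-1 ^+ j.+1.
have y0 : 0 <= y by rewrite mulr_ge0.
have yE : x * q^-1 ^+ j = y * q by rewrite /y exprS; field.
have yq0 : 0 <= y * q by rewrite mulr_ge0 // ltW.
rewrite yE.
have /andP[n1 n2] := truncn_itv y0; have /andP[m1 m2] := truncn_itv yq0.
set n := Num.truncn y in n1 n2 *; set m := Num.truncn (y * q) in m1 m2 *.
have nm : `|n%:R * q - m%:R| <= 1.
  move: n2 m2; rewrite -!natr1 => n2 m2.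
  have h1 : n%:R * q <= y * q by rewrite ler_wpM2r // ltW.
  have h2 : y * q <= n%:R * q + q.
    by rewrite -[X in _ + X]mul1r -mulrDl ler_wpM2r // ltW.
  by have := q1; rewrite ler_norml => q1'; apply/andP; split; lra.
have -> : q ^+ j.+1 * E n - q ^+ j * E m = q ^+ j.+1 * (E n - q^-1 * E m).
  by rewrite exprS; field.
rewrite normrM (ger0_norm (qX0 _)).
apply: le_trans (ler_wpM2l (qX0 _) (E_scale _ _ nm)) _.
have sn : Num.sqrt n.+1%:R <= Num.sqrt (x + 1) * Num.sqrt (q^-1 ^+ j.+1).
  rewrite -sqrtrM ?addr_ge0 // ler_wsqrtr // -natr1 mulrDl mul1r.
  by rewrite lerD.
apply: le_trans (ler_wpM2l (qX0 _) (ler_wpM2l K0 sn)) _.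
have rE : q ^+ j.+1 * Num.sqrt (q^-1 ^+ j.+1) = rho ^+ j.+1.
  have -> : q^-1 ^+ j.+1 = (rho^-1 ^+ j.+1) ^+ 2.
    by rewrite exprAC [rho^-1 ^+ 2]exprVn rho2.
  rewrite sqrtr_sqr ger0_norm ?exprn_ge0 ?invr_ge0 //.
  rewrite -[X in X ^+ _ * _]rho2 -exprM mulnC exprM expr2 exprVn mulfK //.
  by rewrite expf_neq0 // gt_eqF // sqrtr_gt0.
by rewrite -rE le_eqVlt; apply/orP; left; apply/eqP; ring.
Qed.

(** The sum of [K * rho ^+ j] over [j >= 1]. *)
Definition scaling_error : R := K * rho / (1 - rho).

Local Notation M := scaling_error.

Let M0 : 0 <= M.
Proof. by rewrite divr_ge0 ?mulr_ge0 // subr_ge0 ltW. Qed.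

Let tailE x j : K * Num.sqrt (x + 1) * rho ^+ j.+1 =
  M * Num.sqrt (x + 1) * rho ^+ j - M * Num.sqrt (x + 1) * rho ^+ j.+1.
Proof.
have r1 : 1 - rho != 0 by rewrite subr_eq0 gt_eqF.
by rewrite /scaling_error exprS; field.
Qed.

Let upper x j := rescaled x j + M * Num.sqrt (x + 1) * rho ^+ j.

(* Adding the geometric tail turns the summable increments into monotonicity. *)
Lemma upper_noninc x : 0 <= x ->
  {homo upper x : n m / (n <= m)%N >-> (m <= n)}.
Proof.
move=> x0; apply/nonincreasing_seqP => j; rewrite /upper.
have := le_trans (ler_norm _) (rescaled_step _ j x0); rewrite tailE; lra.
Qed.

Lemma lower_nondec x : 0 <= x ->
  {homo (fun j => rescaled x j - M * Num.sqrt (x + 1) * rho ^+ j) :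
    n m / (n <= m)%N >-> (n <= m)}.
Proof.
move=> x0; apply/nondecreasing_seqP => j.
have := rescaled_step _ j x0; rewrite distrC => /(le_trans (ler_norm _)).
rewrite tailE; lra.
Qed.

Definition scaling_limit (x : R) : R := limn (rescaled x).

Let tail_cvg x : (fun j => M * Num.sqrt (x + 1) * rho ^+ j) @ \oo --> (0 : R).
Proof.
rewrite -(mulr0 (M * Num.sqrt (x + 1))); apply: cvgMr; apply: cvg_expr.
by rewrite ger0_norm.
Qed.

Lemma rescaled_cvg x : 0 <= x -> rescaled x @ \oo --> scaling_limit x.
Proof.
move=> x0.
have cu : cvgn (upper x).
  apply: nonincreasing_is_cvgn; first exact: upper_noninc.
  exists 0 => _ [j _ <-].
  apply: addr_ge0; first exact: mulr_ge0.
  by apply: mulr_ge0; [apply: mulr_ge0; rewrite ?sqrtr_ge0 ?M0 | exact: exprn_ge0].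
have : (fun j => upper x j - M * Num.sqrt (x + 1) * rho ^+ j) @ \oo --> limn (upper x) - 0.
  by apply: cvgB => //; exact: tail_cvg.
rewrite (_ : (fun j => _) = rescaled x) => [h|].
  by apply/cvg_ex; exists (limn (upper x) - 0).
by apply/funext => j; rewrite /upper addrK.
Qed.

(** [rescaled n%:R] starts at [E n], and its monotone corrections from above and below bracket the
    limit from index 0 on. *)
Lemma scaling_limit_dist n :
  `|E n - scaling_limit n%:R| <= M * Num.sqrt n.+1%:R.
Proof.
have n0 : 0 <= n%:R :> R by [].
have hu : upper n%:R @ \oo --> scaling_limit n%:R.
  rewrite -[scaling_limit _]addr0; apply: cvgD; [exact: rescaled_cvg | exact: tail_cvg].
have hl : (fun j => rescaled n%:R j - M * Num.sqrt (n%:R + 1) * rho ^+ j) @ \oo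
    --> scaling_limit n%:R.
  rewrite -[scaling_limit _]subr0; apply: cvgB; [exact: rescaled_cvg | exact: tail_cvg].
have E0 : rescaled n%:R 0 = E n by rewrite /rescaled !expr0 mulr1 mul1r natrK.
have u0 : scaling_limit n%:R <= E n + M * Num.sqrt n.+1%:R.
  have /(_ 0) := nonincreasing_cvgn_ge (upper_noninc _ n0) (cvgP _ hu).
  by rewrite (cvg_lim _ hu) // /upper E0 expr0 mulr1 natr1.
have l0 : E n - M * Num.sqrt n.+1%:R <= scaling_limit n%:R.
  have /(_ 0) := nondecreasing_cvgn_le (lower_nondec _ n0) (cvgP _ hl).
  by rewrite (cvg_lim _ hl) // E0 expr0 mulr1 natr1.
by rewrite ler_distl; lra.
Qed.

(** Dividing [x] by [q] shifts the rescaled sequence by one index. *)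
Lemma scaling_limitM x : 0 <= x -> scaling_limit (x / q) = scaling_limit x / q.
Proof.
move=> x0; have xq0 : 0 <= x / q by rewrite divr_ge0 // ltW.
have := rescaled_cvg _ x0; rewrite -cvg_shiftS => h.
apply: (cvg_unique _ (rescaled_cvg _ xq0)) => //.
rewrite (_ : rescaled (x / q) = fun j => rescaled x j.+1 / q).
  by apply: cvgMl.
apply/funext => j; rewrite /rescaled.
have -> : x / q * q^-1 ^+ j = x * q^-1 ^+ j.+1 by rewrite exprS mulrA.
by rewrite [q ^+ j.+1]exprS; field.
Qed.

(** The floors cost at most 1, which the factor [q ^+ j] sends to 0. *)
Lemma scaling_limit_lip x y : 0 <= x -> 0 <= y ->
  `|scaling_limit x - scaling_limit y| <= `|x - y|.
Proof.
move=> x0 y0.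
have h1 : (fun j => `|rescaled x j - rescaled y j|) @ \oo -->
    `|scaling_limit x - scaling_limit y|.
  by apply: cvg_norm; apply: cvgB; exact: rescaled_cvg.
have h2 : (fun j => `|x - y| + q ^+ j) @ \oo --> `|x - y| + 0.
  by apply: cvgD; [exact: cvg_cst | apply: cvg_expr; rewrite ger0_norm // ltW].
rewrite -[leRHS]addr0; apply: (le_cvgn _ _ _ _ _ h1 h2) => j.
rewrite /rescaled -mulrBr normrM (ger0_norm (qX0 _)).
apply: le_trans (ler_wpM2l (qX0 _) (lipschitz_nat _ _ _ _ E_lip)) _.
have xj : 0 <= x * q^-1 ^+ j by rewrite mulr_ge0.
have yj : 0 <= y * q^-1 ^+ j by rewrite mulr_ge0.
have /andP[a1] := truncn_itv xj; have /andP[b1] := truncn_itv yj.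
rewrite -!natr1 => b2 a2.
apply: (@le_trans _ _ (q ^+ j * (`|x * q^-1 ^+ j - y * q^-1 ^+ j| + 1))).
  rewrite ler_wpM2l // ler_norml.
  have := ler_norm (x * q^-1 ^+ j - y * q^-1 ^+ j).
  have := ler_norm (y * q^-1 ^+ j - x * q^-1 ^+ j); rewrite distrC.
  by move=> ? ?; apply/andP; split; lra.
rewrite -mulrBl normrM (ger0_norm (qVX0 _)) mulrDr mulr1 mulrCA qXV mulr1.
exact: lexx.
Qed.

Lemma scaling_limit_ub x : 0 <= x -> scaling_limit x <= B * x.
Proof.
move=> x0; apply: (cvgn_le _ _ _ _ (rescaled_cvg _ x0)) => j.
have xj : 0 <= x * q^-1 ^+ j by rewrite mulr_ge0.
have B0 : 0 <= B by have := le_trans (E_ge0 1) (E_ub 1); rewrite mulr1.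
have /andP[a1 _] := truncn_itv xj.
apply: le_trans (ler_wpM2l (qX0 _) (le_trans (E_ub _) (ler_wpM2l B0 a1))) _.
rewrite (_ : _ * (B * _) = B * x * (q ^+ j * q^-1 ^+ j)); last by ring.
by rewrite qXV mulr1.
Qed.

Lemma scaling_limit_lb x : 0 <= x -> D * x <= scaling_limit x.
Proof.
move=> x0.
have h : (fun j => D * x - D * (1 + c) * q ^+ j) @ \oo --> D * x - D * (1 + c) * 0.
  apply: cvgB; first exact: cvg_cst.
  by apply: cvgMr; apply: cvg_expr; rewrite ger0_norm // ltW.
rewrite mulr0 subr0 in h.
apply: (le_cvgn _ _ _ _ _ h (rescaled_cvg _ x0)) => j.
have xj : 0 <= x * q^-1 ^+ j by rewrite mulr_ge0.
have /andP[_] := truncn_itv xj; rewrite -natr1 => a2.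
rewrite /rescaled; apply: le_trans (ler_wpM2l (qX0 _) (E_lb _)).
set n := Num.truncn _ in a2 *.
apply: (@le_trans _ _ (q ^+ j * (D * (x * q^-1 ^+ j - 1 - c)))).
  rewrite (_ : q ^+ j * _ = D * x * (q ^+ j * q^-1 ^+ j) - D * (1 + c) * q ^+ j); last by ring.
  by rewrite qXV mulr1.
by rewrite ler_wpM2l // ler_wpM2l // lerB // lerBlDr ltW.
Qed.

(** Divided by its argument, the limit is invariant under [x -> x / q], hence 1-periodic in the
    logarithm of [x] to base [q^-1]. *)
Lemma exists_periodic_profile : exists F : R -> R,
  [/\ continuous F, forall x, F (x + 1) = F x, forall x, D <= F x <= B
    & forall n,
       `|E n - n%:R * F (ln n%:R / ln q^-1)| <= scaling_error * Num.sqrt n.+1%:R].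
Proof.
pose L := ln q^-1.
have L0 : 0 < L by rewrite ln_gt0 // invf_gt1.
have eL : expR L = q^-1 by rewrite lnK // posrE invr_gt0.
pose e t := expR (t * L).
have e0 t : 0 < e t by exact: expR_gt0.
have ec : continuous e.
  move=> t; apply: continuous_cvg; first exact: continuous_expR.
  by apply: cvgMl; exact: cvg_id.
exists (fun t => scaling_limit (e t) / e t); split.
- move=> t; apply: cvgM; last by apply: cvgV; [rewrite gt_eqF | exact: ec].
  apply/cvgrPdist_le => eps eps0.
  have /cvgrPdist_le/(_ _ eps0) := ec t.
  apply: filterS => s; apply: le_trans.
  by apply: scaling_limit_lip; exact: ltW.
- move=> t; rewrite {1 2}/e mulrDl mul1r expRD eL -/(e t).
  rewrite scaling_limitM ?(ltW (e0 t)) //.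
  by field; rewrite qn0 gt_eqF.
- move=> t; rewrite ler_pdivlMr // ler_pdivrMr //.
  by rewrite scaling_limit_lb ?scaling_limit_ub // ltW.
(* At [n = 0] the factor [n] cancels the profile, whatever the value of [ln 0]. *)
- case=> [|n].
    have -> : E 0 = 0.
      by apply/eqP; rewrite eq_le E_ge0 andbT; have := E_ub 0; rewrite mulr0.
    by rewrite mul0r subrr normr0 mulr_ge0 ?sqrtr_ge0.
  have -> : e (ln n.+1%:R / L) = n.+1%:R.
    by rewrite /e divfK ?lnK ?posrE ?ltr0n // gt_eqF.
  rewrite mulrCA divff ?pnatr_eq0 // mulr1.
  exact: scaling_limit_dist.
Qed.

End Scaling.

(** * The main expansion *)

Section WordExpectation.
Variables (R : realType) (q : R) (r : nat).
Hypothesis q01 : 0 < q < 1.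

Let q0 : 0 < q. Proof. by case/andP: q01. Qed.
Let q1 : q < 1. Proof. by case/andP: q01. Qed.

Local Notation E := (E_words r.+1 q).
Let below_cvg n : (fun m => below q r.+1 n m) @ \oo --> E n.
Proof. exact: below_cvg_E. Qed.

Lemma E_words_ge0 n : 0 <= E n.
Proof.
apply: (le_cvgn _ _ _ _ _ (cvg_cst 0) (below_cvg n)) => m; exact: below_ge0.
Qed.

Lemma E_words_ub n : E n <= (2 ^+ r.+1)^-1 * n%:R.
Proof.
by apply: (cvgn_le _ _ _ _ (below_cvg n)) => m; rewrite mulrC; exact: below_le.
Qed.

Lemma E_words_lb n :
  q ^+ 'C(r.+2, 2) / 2 ^+ r.+1 * (n%:R - (2 ^ r.+1 - 1)%:R) <= E n.
Proof.
set a := _ * _.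
have hc : cdf q @ \oo --> (1 - 0 : R).
  by apply: cvgB; [exact: cvg_cst | apply: cvg_expr; rewrite ger0_norm // ltW].
have h : (fun m => a * cdf q m ^+ n) @ \oo --> a * (1 - 0) ^+ n.
  by apply: cvgMr; exact: (cvg_comp _ _ hc (@exprn_continuous R n (1 - 0))).
rewrite subr0 expr1n mulr1 in h.
apply: (cvgn_le _ _ _ _ h) => m.
(* Taking [m + r.+1] absorbs the shift in the lower bound. *)
have := below_lb _ _ q01 r.+1 n (m + r.+1); rewrite addnK -/a => /le_trans; apply.
rewrite -(cvg_lim _ (below_cvg n)) //.
apply: (@nondecreasing_cvgn_le _ (fun m => below q r.+1 n m)).
  by apply/nondecreasing_seqP => k; exact: below_leS.
exact: cvgP (below_cvg n).
Qed.

Lemma E_words_lip n : `|E n.+1 - E n| <= 1.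
Proof.
apply: (cvgn_norm_le _ _ _ _ (cvgB (below_cvg n.+1) (below_cvg n))) => m.
exact: below_lip.
Qed.

(** The levels [k.+1] and [k] of the thinning identity merge in the limit. The constant adds the
    thinning defect and the spread of the binomial length. *)
Lemma E_words_scale n m : `|n%:R * q - m%:R| <= 1 ->
  `|E n - q^-1 * E m| <= (q^-1 ^+ r.+2 + q^-1) * Num.sqrt n.+1%:R.
Proof.
move=> nm.
have h : (fun k => below q r.+1 n k.+1 - q^-1 * below q r.+1 m k) @ \oo -->
    E n - q^-1 * E m.
  apply: cvgB; last by apply: cvgMr; exact: below_cvg.
  by have := below_cvg n; rewrite -cvg_shiftS.
apply: (cvgn_norm_le _ _ _ _ h) => k.
set f := fun j => below q r.+1 j k.
have /andP[d0 d1] := below_thin _ _ q01 r.+1 n k.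
have t := thin_lip _ _ q01 f n m (fun i => below_lip _ _ q01 r i k) nm.
have s1 : 1 <= Num.sqrt n.+1%:R :> R by rewrite -[leLHS]sqrtr1 ler_wsqrtr // ler1n.
rewrite (_ : _ - _ = (below q r.+1 n k.+1 - q^-1 * thin q f n)
   + q^-1 * (thin q f n - f m)); last by rewrite /f; ring.
apply: le_trans (ler_normD _ _) _.
have qV0 : 0 <= q^-1 by rewrite invr_ge0 ltW.
rewrite normrM (ger0_norm qV0) (ger0_norm d0) mulrDl lerD //; last first.
  by rewrite ler_wpM2l.
apply: le_trans d1 _; rewrite ler_wpM2l ?exprn_ge0 //.
by apply: le_trans s1; rewrite exprn_ile1 ?cdf_ge0 ?cdf_le1.
Qed.

(** The profile splits into its mean over a period and a zero-mean remainder; the mean inherits the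
    pointwise bounds. *)
Lemma E_words_expansion : exists c : R, exists w : R -> R,
  [/\ q ^+ 'C(r.+2, 2) / 2 ^+ r.+1 <= c <= (2 ^+ r.+1)^-1,
      continuous w, forall x, w (x + 1) = w x,
      (\int[lebesgue_measure]_(x in `[(0:R)%R, (1:R)%R]) (w x)%:E = 0%E)%E
    & (fun n : nat => (E n - c * n%:R - n%:R * w (ln n%:R / ln q^-1)) / n%:R)
        @ \oo --> (0 : R)].
Proof.
have D0 : 0 <= q ^+ 'C(r.+2, 2) / 2 ^+ r.+1.
  by rewrite divr_ge0 ?exprn_ge0 // ltW.
have [F [Fc Fp FB FE]] := exists_periodic_profile _ _ _ _ _ _ _ q01 E_words_lip
  E_words_scale E_words_ge0 E_words_ub D0 E_words_lb.
pose I : set R := `[(0:R)%R, (1:R)%R]%classic.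
have mI : measurable (I : set (measurableTypeR R)) by exact: measurable_itv.
have intc (f : R -> R) : continuous f -> lebesgue_measure.-integrable I (EFin \o f).
  move=> fc; apply: continuous_compact_integrable; first exact: segment_compact.
  exact: continuous_subspaceT.
have cst_c (a : R) : continuous (fun _ : R => a) by move=> ?; exact: cvg_cst.
have Icst a : \int[lebesgue_measure]_(_ in I) a = a.
  by rewrite Rintegral_cst //= /I lebesgue_measure_itv /= lte_fin ltr01 oppr0 adde0 mulr1.
pose c := \int[lebesgue_measure]_(x in I) F x.
exists c, (fun x => F x - c); split.
- rewrite -{1}(Icst (q ^+ _ / _)) -{2}(Icst (2 ^+ r.+1)^-1) /c.
  apply/andP; split; apply: le_Rintegral; rewrite ?(intc _ (cst_c _)) ?intc //.
  + by move=> x _; case/andP: (FB x).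
  + by move=> x _; case/andP: (FB x).
- by move=> x; apply: cvgB; [exact: Fc | exact: cvg_cst].
- by move=> x; rewrite Fp.
- rewrite -/I; under eq_integral do rewrite EFinB.
  rewrite integralB_EFin ?intc //.
  rewrite -(fineK (integrable_fin_num mI (intc _ Fc))).
  rewrite -(fineK (integrable_fin_num mI (intc _ (cst_c c)))).
  rewrite -[fine _]/c -[X in (_ - X%:E)%E]/(\int[lebesgue_measure]_(_ in I) c) Icst.
  by rewrite -EFinB subrr.
- apply: (@cvg_div_nat0 _ _ (scaling_error R q (q^-1 ^+ r.+2 + q^-1))) => n.
  apply: le_trans (FE n); rewrite le_eqVlt; apply/orP; left; apply/eqP.
  by congr (`| _ |); ring.
Qed.

End WordExpectation.

(** * Choice of the constants and the limit at 1 *)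

Theorem mainTheorem9 (R : realType) (r : nat) (hr : (1 <= r)%N) :
  (exists c : R -> R,
     (forall q : R, 0 < q < 1 ->
        exists w : R -> R,
          continuous w /\
          (forall x : R, w (x + 1) = w x) /\
          (\int[lebesgue_measure]_(x in `[(0:R)%R, (1:R)%R]) (w x)%:E = 0%E)%E /\
          ((fun n : nat =>
              (E_words r q n - c q * n%:R
                 - n%:R * w (ln (n%:R) / ln (q^-1))) / n%:R) @ \oo --> 0))
     /\ (c x @[x --> 1^'-] --> ((2 ^+ r)^-1 : R)))
  /\
  ((fun n : nat => (E_perm R r n - n%:R / 2 ^+ r) / n%:R) @ \oo --> 0).
Proof.
split; last exact: E_perm_asymptotics.
case: r hr => // r _.
(* The bounds on [cq] are chosen together with the expansion, since the limit at 1 is squeezed out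
   of them. *)
pose P (q cq : R) := q ^+ 'C(r.+2, 2) / 2 ^+ r.+1 <= cq <= (2 ^+ r.+1)^-1 /\
  exists w : R -> R, [/\ continuous w, forall x, w (x + 1) = w x,
    (\int[lebesgue_measure]_(x in `[(0:R)%R, (1:R)%R]) (w x)%:E = 0%E)%E
    & (fun n : nat => (E_words r.+1 q n - cq * n%:R
         - n%:R * w (ln n%:R / ln q^-1)) / n%:R) @ \oo --> (0 : R)].
have [c Hc] : {c : R -> R & forall q : R, 0 < q < 1 -> P q (c q)}.
  apply: (@choice _ _ (fun q cq => 0 < q < 1 -> P q cq)) => q.
  (* Outside the unit interval the constant is set to 0, which the left limit at 1 does not see. *)
  have [q01|nq] := boolP (0 < q < 1); last by exists 0.
  have [c [w [cb wc wp wI wE]]] := E_words_expansion _ _ r q01.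
  by exists c => _; split=> //; exists w; split.
exists c; split.
  by move=> q /Hc[_ [w [wc wp wI wE]]]; exists w.
apply: (@squeeze_cvgr _ _ _ _ (fun q => q ^+ 'C(r.+2, 2) / 2 ^+ r.+1)
    (fun=> (2 ^+ r.+1)^-1)).
- near=> q; apply: (Hc q _).1; apply/andP; split; near: q.
  + exact: nbhs_left_gt.
  + exact: nbhs_left_lt.
- rewrite -[X in _ --> X]mul1r -[X in X * _](expr1n _ 'C(r.+2, 2)).
  apply: cvgMl; apply: (cvg_at_left_filter (@exprn_continuous R 'C(r.+2, 2) 1)).
- exact: cvg_cst.
Unshelve. all: by end_near. Qed.
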